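(* Let $(G,+)$ be an abelian group, let $A\subseteq G$ be a finite set with $|A|>1$, let $K\ge 1$ be a real number and let $k\ge 2$ be an integer. Suppose that $\mathsf{E}^+(A)\ge |A|^3/K$. Then there are sets $A_*\subseteq A$ and $P\subseteq A-A$ such that $|A_*|\ge |A|/(8kK)$, $|P|\le 8kK|A|$, and for any $a_1,\dots,a_k\in A_*$ one has $$|A\cap(P+a_1)\cap\dots\cap(P+a_k)|\ge\frac{|A|}{4K}.$$
   Context: $\mathsf{E}^+(A)$ is the number of $(x_1,x_2,x_3,x_4)\in A^4$ with $x_1+x_3=x_2+x_4$. $A-A=\{a-b:a,b\in A\}$ and $P+a=\{s+a: s\in P\}$. *)

(* Defs.v *)
From HB Require Import structures.
From mathcomp Require Import all_boot all_order all_algebra finmap reals.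

Set Implicit Arguments.
Unset Strict Implicit.
Unset Printing Implicit Defensive.

Import Order.TTheory GRing.Theory Num.Theory.

Local Open Scope fset_scope.
Local Open Scope ring_scope.

(* A quadruple (x1, x2, x3, x4) is the left-nested pair (((x1, x2), x3), x4). *)
Definition add_energy (G : zmodType) (A : {fset G}) : nat :=
  #|` [fset x in A `*` A `*` A `*` A |
        x.1.1.1 + x.1.2 == x.1.1.2 + x.2] |.

Definition diffset (G : zmodType) (A : {fset G}) : {fset G} :=
  [fset a - b | a in A, b in A].

Definition translate (G : zmodType) (P : {fset G}) (a : G) : {fset G} :=
  [fset s + a | s in P].

(* Main.v *)
Require Import Defs.
From HB Require Import structures.
From mathcomp Require Import all_boot all_order all_algebra finmap reals.
From mathcomp Require Import zify lra.

Set Implicit Arguments.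
Unset Strict Implicit.
Unset Printing Implicit Defensive.

Import Order.TTheory GRing.Theory Num.Theory.

Local Open Scope fset_scope.
Local Open Scope ring_scope.

(** Write [n = #|A|], [D = A - A], [A_s = {x in A : x + s in A}] and
    [r s = #|A_s|], so that [r s] counts the representations of [s] as a
    difference of elements of [A].  Let [P] consist of the popular differences,
    those with [8kK * r d >= n].  Since the [r d] sum to [n ^ 2] over [D]
    ([sum_shift_card]), [P] has at most [8kK * n] elements.

    The set [Astar] is found inside a single slice [A_s], chosen by averaging
    over [s].  Call a pair [(x, a)] of elements of [A_s] bad if [x - a] is not
    popular.  A given pair [(x, a)] of elements of [A] lies in exactly
    [r (x - a)] slices, because [(x + s) - (a + s) = x - a].  Hence the slices
    contain [\sum_d (r d) ^ 2 = E(A) >= n ^ 3 / K] pairs in total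
    ([add_energyE]), while the bad ones number [\sum_(d notin P) (r d) ^ 2]
    ([sum_bad_pairs]), which by the choice of [P] is at most [n ^ 3 / (8kK)].
    So on average a slice has at most a proportion [1 / (8k)] of bad pairs.
    Giving up a factor 2, one finds a slice which in addition is not small:
    [2K * r s >= n], with a proportion at most [1 / (4k)] of bad pairs
    ([exists_good_shift]).

    In such a slice, at least half of the elements [a] are in few bad pairs, at
    most [r s / (2k)] each; they form [Astar].  Any [k] of them together exclude
    at most half of the slice, and every remaining [x] satisfies
    [x - a_i \in P] for all [i] ([common_core]).  Both halves have size at least
    [n / (4K)]. *)

(** * Counting in finite sets *)

Lemma card_sep (T : choiceType) (A : {fset T}) (P : pred T) :
  #|` [fset x in A | P x]| = (\sum_(x <- A) P x)%N.
Proof.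
rewrite card_fset_sum1 big_fset /= big_mkcond /=.
by apply: eq_bigr => x _; case: (P x).
Qed.

Lemma sum_fsetM (S T : choiceType) (A : {fset S}) (B : {fset T})
    (F : S * T -> nat) :
  (\sum_(u <- A `*` B) F u = \sum_(x <- A) \sum_(y <- B) F (x, y))%N.
Proof.
rewrite -big_allpairs; apply: perm_big; apply: uniq_perm => //.
  by apply: allpairs_uniq => // -[? ?] [? ?].
case=> x y; rewrite in_fsetM.
by apply/andP/allpairsP => [[xA yB]|[[? ?] /= [? ? [-> ->]]]] //; exists (x, y).
Qed.

(** * Common neighbours in a dense graph *)

(** The core consists of the vertices whose degree is at most twice the average
    allowed by the hypothesis, i.e. at most [#|B| / (2k)].  By Markov's
    inequality it contains half of [B], and by the union bound [k] of its
    elements have at most [#|B| / 2] neighbours altogether. *)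
Lemma common_core (T : choiceType) (B : {fset T}) (k : nat) (e : rel T) :
  (0 < k)%N ->
  (4 * k * (\sum_(a <- B) #|` [fset x in B | e x a]|) <= #|` B| ^ 2)%N ->
  exists C : {fset T}, [/\ C `<=` B, (#|` B| <= 2 * #|` C|)%N
    & forall a : 'I_k -> T, (forall i, a i \in C) ->
      (#|` B| <= 2 * #|` [fset x in B | [forall i, ~~ e x (a i)]]|)%N].
Proof.
move=> k_gt0 few; pose deg a := #|` [fset x in B | e x a]|.
exists [fset a in B | (2 * k * deg a <= #|` B|)%N]; split.
- by apply/fsubsetP => x; rewrite !inE => /andP[].
- have [->|B_gt0] := posnP #|` B|; first by [].
  rewrite card_sep; set c := (\sum_(a <- B) _)%N.
  (* Markov's inequality: a vertex outside the core has 2k deg a > #|B|. *)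
  have : (#|` B| * #|` B| <= \sum_(a <- B)
           (#|` B| * (2 * k * deg a <= #|` B|) + 2 * k * deg a))%N.
    rewrite {1}card_fset_sum1 big_distrl /=; apply: leq_sum => a _.
    by case: leqP => /=; lia.
  rewrite big_split /= -!big_distrr /= -/c.
  move: few; rewrite -/deg; set S := (\sum_(a <- B) _)%N => few h.
  rewrite -(leq_pmul2l B_gt0); lia.
- move=> a aC.
  have a_small i : (2 * k * deg (a i) <= #|` B|)%N.
    by have := aC i; rewrite !inE => /andP[].
  have union : (#|` B| <= #|` [fset x in B | [forall i, ~~ e x (a i)]]|
                         + \sum_(i < k) deg (a i))%N.
    under [X in (_ + X)%N]eq_bigr do rewrite /deg card_sep.
    rewrite card_sep exchange_big -big_split /= {1}card_fset_sum1.
    apply: leq_sum => x _; case: (boolP [forall _, _]) => //= /forallPn[i].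
    by rewrite negbK (bigD1 i) //= => ->.
  have sum_small : (k * (2 * \sum_(i < k) deg (a i)) <= k * #|` B|)%N.
    rewrite mulnA (mulnC k) big_distrr /= -[X in (_ <= X * _)%N](card_ord k).
    rewrite -sum_nat_const; exact: leq_sum.
  move: sum_small; rewrite leq_pmul2l //; lia.
Qed.

(** * Representations of differences *)

Section Differences.
Variables (G : zmodType) (A : {fset G}).

Definition shift_part (d : G) : {fset G} := [fset x in A | x + d \in A].

(** Translation by [x] maps the differences [d] with [x + d \in A] bijectively
    onto [A]; no element of [A] is missed because [x] itself lies in [A]. *)
Lemma sum_shifts (x : G) (F : G -> nat) : x \in A ->
  (\sum_(d <- diffset A) ((x + d)%R \in A) * F (x + d)%R = \sum_(y <- A) F y)%N.
Proof.
move=> xA.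
have -> : (\sum_(y <- A) F y =
    \sum_(d <- [seq (y - x)%R | y <- A]) F (x + d)%R)%N.
  by rewrite big_map; apply: eq_bigr => y _; rewrite addrC subrK.
rewrite [LHS](eq_bigr (fun d => if (x + d)%R \in A then F (x + d)%R else 0%N)); last first.
  by move=> d _; case: ifP; rewrite (mul1n, mul0n).
rewrite -big_mkcond -big_filter; apply: perm_big; apply: uniq_perm.
- by rewrite filter_uniq // fset_uniq.
- by rewrite (map_inj_uniq (addIr _)) fset_uniq.
move=> d; rewrite mem_filter; apply/andP/mapP => [[xdA _]|[y yA ->]].
  by exists (x + d); rewrite // addrAC subrr add0r.
rewrite [x + _]addrC subrK; split=> //.
by apply/imfset2P; exists y => //; exists x.
Qed.

(** Grouping the pairs [(x, y)] by their difference: the pairs with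
    [y - x = d] are indexed by [x \in shift_part d]. *)
Lemma sum_over_differences (F : G -> nat) :
  (\sum_(d <- diffset A) #|` shift_part d| * F d =
   \sum_(x <- A) \sum_(y <- A) F (y - x)%R)%N.
Proof.
under eq_bigr do rewrite card_sep big_distrl /=.
rewrite exchange_big /= !big_seq; apply: eq_bigr => x xA.
rewrite -(sum_shifts _ xA); apply: eq_bigr => d _.
by rewrite [x + d]addrC addrK.
Qed.

Lemma sum_shift_card :
  (\sum_(d <- diffset A) #|` shift_part d| = #|` A| ^ 2)%N.
Proof.
have := sum_over_differences (fun=> 1%N).
under eq_bigr do rewrite muln1.
move->; rewrite -mulnn {1}card_fset_sum1 big_distrl /=.
by apply: eq_bigr => x _; rewrite mul1n card_fset_sum1.
Qed.

(** In a quadruple with [x1 + x3 = x2 + x4] the last entry is determined, so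
    that a pair [(x1, x2)] extends to as many quadruples as there are [x3] with
    [x3 + (x1 - x2) \in A]. *)
Lemma add_energyE :
  add_energy A = (\sum_(d <- diffset A) #|` shift_part d| ^ 2)%N.
Proof.
under eq_bigr do rewrite -mulnn.
rewrite sum_over_differences /add_energy card_sep !sum_fsetM /=.
rewrite exchange_big; apply: eq_bigr => x _; apply: eq_bigr => y _.
rewrite card_sep; apply: eq_bigr => z _.
rewrite -(count_uniq_mem _ (fset_uniq A)) -sum1_count [RHS]big_mkcond /=.
apply: eq_bigr => w _.
by rewrite (addrC y) (addrC x) -subr_eq eq_sym addrA; case: eqP.
Qed.

(** A pair [(x, a)] is contained in [shift_part s] exactly when [a + s] and
    [(a + s) + (x - a)] both lie in [A]; letting [s] vary, [a + s] runs through
    [shift_part (x - a)]. *)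
Lemma sum_bad_pairs (P : {fset G}) :
  (\sum_(s <- diffset A) \sum_(a <- shift_part s)
     #|` [fset x in shift_part s | (x - a)%R \notin P]| =
   \sum_(d <- diffset A) #|` shift_part d| * (#|` shift_part d| * (d \notin P)))%N.
Proof.
rewrite sum_over_differences.
transitivity (\sum_(s <- diffset A) \sum_(a <- A) \sum_(x <- A)
   ((a + s)%R \in A) * ((x + s)%R \in A) * ((x - a)%R \notin P))%N.
  apply: eq_bigr => s _; rewrite big_fset big_mkcond /=.
  apply: eq_bigr => a _; case: (a + s \in A); last by rewrite big1.
  rewrite card_sep big_fset big_mkcond /=; apply: eq_bigr => x _.
  by case: (x + s \in A); rewrite ?muln0 ?mul0n ?mul1n.
rewrite exchange_big /= !big_seq; apply: eq_bigr => a aA.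
rewrite exchange_big /=; apply: eq_bigr => x _.
rewrite -big_distrl /= card_sep; congr (_ * _)%N.
rewrite -(sum_shifts _ aA); apply: eq_bigr => s _.
by have -> : a + s + (x - a) = x + s by rewrite addrC addrA subrK.
Qed.

End Differences.

(** * The averaging argument *)

(** Both conclusions follow from nonnegativity of the single quantity
    [2K (r s)^2 - 2Km * bad s - n * r s], whose sum over [s] is nonnegative:
    the first term contributes at least [2 n ^ 3], and each of the others costs
    at most [n ^ 3]. *)
Lemma exists_good_shift (R : realFieldType) (G : zmodType) (A P : {fset G})
    (K : R) (m : nat) :
  (0 < #|` A|)%N -> 0 < K -> (#|` A|%:R ^+ 3 / K <= (add_energy A)%:R) ->
  (forall d, d \in diffset A -> d \notin P ->
     2 * m%:R * K * #|` shift_part A d|%:R <= #|` A|%:R) ->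
  exists s, [/\ #|` A|%:R <= 2 * K * #|` shift_part A s|%:R
    & (m * (\sum_(a <- shift_part A s)
         #|` [fset x in shift_part A s | (x - a)%R \notin P]|)
       <= #|` shift_part A s| ^ 2)%N].
Proof.
move=> A_gt0 K_gt0 hE rare; set n : R := #|` A|%:R.
pose r s : R := #|` shift_part A s|%:R.
pose bad s := (\sum_(a <- shift_part A s)
         #|` [fset x in shift_part A s | (x - a)%R \notin P]|)%N.
have n_gt0 : 0 < n by rewrite ltr0n.
have sum_r : \sum_(s <- diffset A) r s = n ^+ 2.
  by rewrite -natr_sum sum_shift_card natrX.
have sum_r2 : \sum_(s <- diffset A) r s ^+ 2 = (add_energy A)%:R.
  by rewrite add_energyE natr_sum; apply: eq_bigr => s _; rewrite natrX.
have sum_bad : 2 * m%:R * K * \sum_(s <- diffset A) (bad s)%:R <= n * n ^+ 2.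
  rewrite -natr_sum sum_bad_pairs natr_sum -sum_r !big_distrr /=.
  rewrite !big_seq; apply: ler_sum => d dD; rewrite !natrM -/(r d).
  have r_ge0 : 0 <= r d by [].
  have [dP|dP] := boolP (d \in P); first by rewrite !mulr0 mulr_ge0 // ltW.
  by rewrite mulr1 mulrA ler_wpM2r // rare.
pose gain s := 2 * K * r s ^+ 2 - 2 * K * m%:R * (bad s)%:R - n * r s.
have gain_ge0 : 0 <= \sum_(s <- diffset A) gain s.
  rewrite !sumrB -!mulr_sumr sum_r sum_r2.
  move: hE; rewrite ler_pdivrMr //; lra.
have [s sD gs] : exists2 s, s \in diffset A & 0 <= gain s.
  apply/hasP; apply: contraLR gain_ge0 => /hasPn none; rewrite -ltNge.
  have /fset0Pn[a aA] : A != fset0 by rewrite -cardfs_gt0.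
  have D0 : a - a \in diffset A by apply/imfset2P; exists a => //; exists a.
  have zero : \sum_(s <- diffset A) (0 : R) = 0 by rewrite big1.
  rewrite -[ltRHS]zero !big_seq.
  apply: ltr_sum => [|s sD]; last by rewrite ltNge none.
  by apply/hasP; exists (a - a).
(* The gain also vanishes on an empty slice; [s \in diffset A] excludes it. *)
have r_gt0 : 0 < r s.
  case/imfset2P: sD => /= a aA [b bA sE]; rewrite ltr0n cardfs_gt0.
  by apply/fset0Pn; exists b; rewrite !inE /= bA sE addrC subrK.
have loss1 : 0 <= K * (m%:R * (bad s)%:R) by rewrite !mulr_ge0 // ltW.
have loss2 : 0 <= n * r s by rewrite mulr_ge0 // ltW.
rewrite /gain in gs; exists s; rewrite -/(r s) -/(bad s); split.
  rewrite -(ler_pM2r r_gt0); lra.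
rewrite -(ler_nat R) natrM natrX -/(r s) -(ler_pM2l K_gt0); lra.
Qed.

(** * Popular differences *)

Theorem theorem14 (R : realType) (G : zmodType) (A : {fset G}) (K : R) (k : nat)
  (hA : (1 < #|` A|)%N) (hK : 1 <= K) (hk : (2 <= k)%N)
  (hE : #|` A|%:R ^+ 3 / K <= (add_energy A)%:R) :
  exists Astar P : {fset G},
    [/\ Astar `<=` A,
        P `<=` diffset A,
        #|` A|%:R / (8 * k%:R * K) <= #|` Astar|%:R,
        #|` P|%:R <= 8 * k%:R * K * #|` A|%:R
      & forall a : 'I_k -> G, (forall i, a i \in Astar) ->
          #|` A|%:R / (4 * K)
            <= #|` (\big[fsetI/A]_(i < k) translate P (a i))|%:R].
Proof.
set n : R := #|` A|%:R.
have K_gt0 : 0 < K by lra.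
have k_gt0 : 0 < k%:R :> R by rewrite ltr0n; lia.
have n_gt0 : 0 < n by rewrite ltr0n; lia.
have c_gt0 : 0 < 8 * k%:R * K by rewrite !mulr_gt0.
pose r s : R := #|` shift_part A s|%:R.
pose P := [fset d in diffset A | n <= 8 * k%:R * K * r d].
have P_small : #|` P|%:R <= 8 * k%:R * K * n.
  rewrite -(ler_pM2r n_gt0) -[leRHS]mulrA -expr2 -natrX -sum_shift_card natr_sum.
  rewrite card_sep natr_sum big_distrl big_distrr /=.
  apply: ler_sum => d _; case: (leP n) => [nr|_]; rewrite ?mul1r // mul0r.
  by rewrite mulr_ge0 // ltW.
have rare d : d \in diffset A -> d \notin P ->
    2 * (4 * k)%:R * K * #|` shift_part A d|%:R <= n.
  move=> dD; rewrite !inE dD /= -ltNge -/(r d) natrM => /ltW; lra.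
(* The [m] of the averaging is [4k], the density asked for by the core. *)
have [|s [s_large s_bad]] := exists_good_shift _ K_gt0 hE rare; first by lia.
have [|C [C_sub C_large C_good]] := common_core _ s_bad; first by lia.
have half : n / (4 * K) <= r s / 2.
  by rewrite ler_pdivrMr ?mulr_gt0 //; move: s_large; rewrite -/n -/(r s); lra.
have A_sub : shift_part A s `<=` A.
  by apply/fsubsetP => x; rewrite !inE => /andP[].
exists C, P; split=> //.
- exact: fsubset_trans A_sub.
- by apply/fsubsetP => d; rewrite !inE => /andP[].
- have : r s <= 2 * #|` C|%:R by rewrite -natrM ler_nat.
  move=> rC; apply: (@le_trans _ _ (n / (4 * K))); last by lra.
  rewrite ler_pM2l // lef_pV2 ?posrE ?mulr_gt0 // ler_pM2r //.
  have : 1 <= k%:R :> R by rewrite ler1n; lia.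
  lra.
- move=> a aC; have := C_good a aC.
  rewrite -(ler_nat R) natrM -/(r s) => good_large.
  apply: (@le_trans _ _ (#|` [fset x in shift_part A s |
      [forall i, ~~ (x - a i \notin P)]]|%:R)); first lra.
  rewrite ler_nat; apply/fsubset_leq_card/fsubsetP => x.
  rewrite !inE => /andP[/andP[xA _] /forallP xP].
  apply: (big_ind (fun S : {fset G} => x \in S)) => // [S T xS xT|i _].
    by rewrite inE xS.
  apply/imfsetP; exists (x - a i); last by rewrite subrK.
  by have := xP i; rewrite negbK.
Qed.
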